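(* Let $H$ be a cosemisimple Hopf algebra and $(A,\Omega^1(A),H,\delta)$ a quantum principal $H$-bundle. Then its Hopf-image reduction $(A_0,\Omega^1(A_0),H_\delta,\overline{\delta}_{\mathrm{im}})$ is a quantum principal $H_\delta$-bundle whose right coaction $\overline{\delta}_{\mathrm{im}}$ is inner faithful. In particular, if $H$ is a cosemisimple Hopf algebra, then every quantum principal $H$-bundle admits a canonical reduction (namely its Hopf-image reduction) to a quantum principal bundle with effective, i.e. inner-faithful, quantum symmetry.
   Context: All vector spaces, algebras and tensor products are over a fixed ground field $k$. Algebras are associative and unital. A Hopf algebra $H$ has coproduct $\Delta$, counit $\varepsilon$ and bijective antipode $S$. A right coaction of $H$ on an algebra $A$ is a linear map $\delta : A\to A\otimes H$, $\delta(a)=a_{(0)}\otimes a_{(1)}$, with $(\delta\otimes\mathrm{id}_H)\circ\delta=(\mathrm{id}_A\otimes\Delta)\circ\delta$ and $(\mathrm{id}_A\otimes\varepsilon)\circ\delta=\mathrm{id}_A$. A right $H$-comodule algebra is an algebra with a right coaction that is an algebra homomorphism. A Hopf subalgebra is a unital subalgebra that is a subcoalgebra and stable under the antipode. First-order differential calculi. A first-order differential calculus (fodc) over $A$ is a pair $(\Omega^1(A),\mathrm{d})$ with $\Omega^1(A)$ an $A$-bimodule and $\mathrm{d}:A\to\Omega^1(A)$ a derivation such that $\Omega^1(A)$ is generated as a left $A$-module by the elements $\mathrm{d}a$. For a right $H$-comodule algebra $A$ it is right $H$-covariant if $\Delta_R:\Omega^1(A)\to\Omega^1(A)\otimes H$,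 $\Delta_R(a\,\mathrm{d}b)=a_{(0)}\mathrm{d}b_{(0)}\otimes a_{(1)}b_{(1)}$, is well defined. The universal calculus is $\Omega^1_u(A)=\ker(A\otimes A\to A)$ (kernel of multiplication) with $\mathrm{d}_ua=1\otimes a-a\otimes 1$; every fodc is a quotient $\Omega^1_u(A)/N$ by a sub-bimodule $N$. The map $\mathrm{ver}:\Omega^1_u(A)\to A\otimes H^+$ is $\mathrm{ver}(\sum a\otimes b)=\sum a\,b_{(0)}\otimes b_{(1)}$, where $H^+=\ker\varepsilon$. Quantum principal bundles. A quantum principal $H$-bundle $(A,\Omega^1(A),H,\delta)$ consists of a right $H$-comodule algebra $(A,\delta)$ and a right $H$-covariant fodc $\Omega^1(A)$ such that: (1) with $B=A^{\mathrm{co}(H)}=\{a\in A:\delta(a)=a\otimes 1_H\}$, the canonical map $\mathrm{can}:A\otimes_BA\to A\otimes H$, $a\otimes a'\mapsto a\,a'_{(0)}\otimes a'_{(1)}$, is bijective; (2) if $N\subset\Omega^1_u(A)$ is the sub-bimodule corresponding to $\Omega^1(A)$, then $\mathrm{ver}(N)=A\otimes Q$ for some right ideal $Q\subseteq H^+$ with $\mathrm{Ad}_R(Q)\subseteq Q\otimes H$, where $\mathrm{Ad}_R(h)=h_{(2)}\otimes S(h_{(1)})h_{(3)}$. Hopf image. The Hopf image $H_\delta$ of a right coaction $\delta:A\to A\otimes H$ is the smallest Hopf subalgebra $L\subseteq H$ with $\delta(A)\subseteq A\otimes L$; $\delta_{\mathrm{im}}:A\to A\otimes H_\delta$ denotes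 the corestriction of $\delta$. The coaction $\delta$ is inner faithful if $H_\delta=H$. Hopf-image reduction. Let $I\subseteq A$ be the largest two-sided ideal with $\delta_{\mathrm{im}}(I)\subseteq I\otimes H_\delta$, $A_0:=A/I$, $\pi:A\to A_0$ the quotient map, and $\overline{\delta}_{\mathrm{im}}:A_0\to A_0\otimes H_\delta$ the induced coaction, $\overline{\delta}_{\mathrm{im}}\circ\pi=(\pi\otimes\mathrm{id})\circ\delta_{\mathrm{im}}$. $\Omega^1(A_0)$ is the induced calculus $\Omega^1(A)/(I\,\Omega^1(A)+\Omega^1(A)\,I+A\,\mathrm{d}(I)\,A)$ with the induced differential. The Hopf-image reduction is the quadruple $(A_0,\Omega^1(A_0),H_\delta,\overline{\delta}_{\mathrm{im}})$.
   Formalization: The largest ideal I with δ_im(I) ⊆ I⊗H_δ is always A, giving A_0 = 0, where inner faithfulness fails; here algebras are nonzero and I is any ideal maximal among the proper two-sided ideals with this property (one exists; it need not be unique, so the reduction need not be canonical). *)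

(* Defs.v *)
From HB Require Import structures.
From mathcomp Require Import all_boot all_algebra.
From mathcomp Require Import generic_quotient ring_quotient sesquilinear.
From mathcomp Require Import boolp classical_sets.
From mathcomp.multinomials Require freeg.

Set Implicit Arguments.
Unset Strict Implicit.
Unset Printing Implicit Defensive.

Import GRing.Theory.
Import freeg.

Local Open Scope classical_set_scope.
Local Open Scope ring_scope.
Local Open Scope quotient_scope.

Reserved Notation "v ⊗ w" (at level 40, left associativity).

Local Notation bilinear f := (bilinear_for *:%R *:%R f).

Section Subspaces.
Context {k : fieldType} {V : lmodType k}.

Definition subspace (S : set V) : Prop :=
  S 0 /\ forall (c : k) u v, S u -> S v -> S (c *: u + v).

Definition span (X : set V) : set V := smallest subspace X.

Lemma span_subspace (X : set V) : subspace (span X).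
Proof.
split=> [S [[]]//|c u v Xu Xv S [sS XS]].
by apply: sS.2; [apply: Xu|apply: Xv].
Qed.

Lemma span_gen (X : set V) : X `<=` span X.
Proof. exact: sub_gen_smallest. Qed.

Lemma span_min (X S : set V) : subspace S -> X `<=` S -> span X `<=` S.
Proof. exact: smallest_sub. Qed.

End Subspaces.

Section QuotientSpace.
Context {k : fieldType} {V : lmodType k} (X : set V).

Definition span_pred : {pred V} := fun v => v \in span X.

Lemma span_predE v : v \in span_pred = (v \in span X). Proof. by []. Qed.

Lemma span_pred_zmod : zmod_closed span_pred.
Proof.
have [s0 sS] := span_subspace X.
split=> [|u v]; rewrite !span_predE ?inE // => su sv.
by rewrite addrC -scaleN1r; apply: sS.
Qed.
HB.instance Definition _ := GRing.isZmodClosed.Build V span_pred span_pred_zmod.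

Definition quotv : Type := ring_quotient.Quotient.quot span_pred.
HB.instance Definition _ := GRing.Zmodule.on quotv.

Definition qproj (v : V) : quotv := \pi_(ring_quotient.Quotient.quot span_pred) v.

Definition qscale (c : k) (x : quotv) : quotv := qproj (c *: repr (x : ring_quotient.Quotient.quot span_pred)).

Lemma qproj_eqP u v : qproj u = qproj v <-> span X (u - v).
Proof.
rewrite /qproj; split=> [/eqP|uv]; last first.
  by apply/eqP; rewrite -Quotient.idealrBE span_predE inE.
by rewrite -Quotient.idealrBE span_predE inE.
Qed.

Lemma qprojD : {morph qproj : u v / u + v}.
Proof. by move=> u v; rewrite /qproj !piE. Qed.

Lemma qproj_surj (x : quotv) : exists v, qproj v = x.
Proof. by exists (repr (x : ring_quotient.Quotient.quot span_pred)); rewrite /qproj reprK. Qed.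

Lemma qscaleE c v : qscale c (qproj v) = qproj (c *: v).
Proof.
apply/qproj_eqP; rewrite -scalerBr -[_ *: _]addr0.
apply: (span_subspace X).2; last exact: (span_subspace X).1.
by apply/qproj_eqP; rewrite /qproj reprK.
Qed.

Lemma qscaleA a b x : qscale a (qscale b x) = qscale (a * b) x.
Proof. by have [v <-] := qproj_surj x; rewrite !qscaleE scalerA. Qed.
Lemma qscale1 : left_id 1 qscale.
Proof. by move=> x; have [v <-] := qproj_surj x; rewrite qscaleE scale1r. Qed.
Lemma qscaleDr : right_distributive qscale +%R.
Proof.
move=> c x y; have [v <-] := qproj_surj x; have [u <-] := qproj_surj y.
by rewrite -qprojD !qscaleE scalerDr qprojD.
Qed.
Lemma qscaleDl x : {morph qscale^~ x : a b / a + b}.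
Proof.
by move=> a b; have [v <-] := qproj_surj x; rewrite !qscaleE scalerDl qprojD.
Qed.

HB.instance Definition _ := GRing.Zmodule_isLmodule.Build k quotv
  qscaleA qscale1 qscaleDr qscaleDl.

Lemma qproj_linear : linear qproj.
Proof. by move=> c u v; rewrite qprojD -qscaleE. Qed.
HB.instance Definition _ := GRing.isLinear.Build k V quotv _ qproj qproj_linear.

Definition qlift {U : lmodType k} (f : {linear V -> U})
    of (forall x, X x -> f x = 0) : quotv -> U :=
  fun x => f (repr (x : ring_quotient.Quotient.quot span_pred)).

Section Lift.
Context {U : lmodType k} (f : {linear V -> U}) (fX : forall x, X x -> f x = 0).

Lemma qliftE v : qlift fX (qproj v) = f v.
Proof.
apply/eqP; rewrite -subr_eq0 -linearB; apply/eqP.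
apply: (@span_min _ _ X [set x | f x = 0]) => //.
  by split=> [|c u w /= fu fw]; rewrite /= ?linear0 // linearP fu fw scaler0 addr0.
by apply/qproj_eqP; rewrite /qproj reprK.
Qed.

Lemma qlift_linear : linear (qlift fX).
Proof.
move=> c x y; have [v <-] := qproj_surj x; have [u <-] := qproj_surj y.
by rewrite -linearP !qliftE linearP.
Qed.
HB.instance Definition _ :=
  GRing.isLinear.Build k quotv U _ (qlift fX) qlift_linear.

End Lift.
End QuotientSpace.

Section Tensor.
Context {k : fieldType}.

Section Construction.
Variables V W : lmodType k.

Definition tens_rel : set {freeg (V * W) / k} :=
  [set x | (exists c u v w,
              x = << (c *: u + v, w) >> - (c *: << (u, w) >> + << (v, w) >>))
        \/ (exists c v u w,
              x = << (v, c *: u + w) >> - (c *: << (v, u) >> + << (v, w) >>))].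

Record tens : Type := Tens { untens : quotv tens_rel }.

Lemma untensK : cancel untens Tens. Proof. by case. Qed.
HB.instance Definition _ := Choice.copy tens (can_type untensK).

Definition tens_add x y := Tens (untens x + untens y).
Definition tens_opp x := Tens (- untens x).
Definition tens_scale (c : k) x := Tens (c *: untens x).

Fact tens_addA : associative tens_add.
Proof. by move=> x y z; congr Tens; apply: addrA. Qed.
Fact tens_addC : commutative tens_add.
Proof. by move=> x y; congr Tens; apply: addrC. Qed.
Fact tens_add0 : left_id (Tens 0) tens_add.
Proof. by case=> x; congr Tens; apply: add0r. Qed.
Fact tens_addN : left_inverse (Tens 0) tens_opp tens_add.
Proof. by move=> x; congr Tens; apply: addNr. Qed.
HB.instance Definition _ :=
  GRing.isZmodule.Build tens tens_addA tens_addC tens_add0 tens_addN.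

Fact tens_scaleA a b x : tens_scale a (tens_scale b x) = tens_scale (a * b) x.
Proof. by congr Tens; apply: scalerA. Qed.
Fact tens_scale1 : left_id 1 tens_scale.
Proof. by case=> x; congr Tens; apply: scale1r. Qed.
Fact tens_scaleDr : right_distributive tens_scale +%R.
Proof. by move=> c x y; congr Tens; apply: scalerDr. Qed.
Fact tens_scaleDl x : {morph tens_scale^~ x : a b / a + b}.
Proof. by move=> a b; congr Tens; apply: scalerDl. Qed.
HB.instance Definition _ := GRing.Zmodule_isLmodule.Build k tens
  tens_scaleA tens_scale1 tens_scaleDr tens_scaleDl.

Fact untens_linear : linear untens. Proof. by []. Qed.
HB.instance Definition _ :=
  GRing.isLinear.Build k tens (quotv tens_rel) _ untens untens_linear.

Definition tpure (v : V) (w : W) : tens := Tens (qproj tens_rel << (v, w) >>).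

End Construction.

Local Notation "v ⊗ w" := (tpure v w) : ring_scope.

Lemma tpure_bilinear (V W : lmodType k) : bilinear (@tpure V W).
Proof.
split=> [w|v] c a b; congr Tens; rewrite /= -linearP; apply/qproj_eqP;
  apply: span_gen; rewrite /tens_rel /mkset.
  by left; exists c, a, b, w.
by right; exists c, v, a, b.
Qed.

Definition tpurel {V W : lmodType k} (v : V) : W -> tens V W := tpure v.
HB.instance Definition _ (V W : lmodType k) v :=
  GRing.isLinear.Build k W (tens V W) _ (tpurel v) ((tpure_bilinear V W).2 v).

Definition tpurer {V W : lmodType k} (w : W) : V -> tens V W := fun v => v ⊗ w.
HB.instance Definition _ (V W : lmodType k) w :=
  GRing.isLinear.Build k V (tens V W) _ (tpurer w) ((tpure_bilinear V W).1 w).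

HB.instance Definition _ (K : choiceType) (U : lmodType k) (f : K -> U) :=
  GRing.isZmodMorphism.Build {freeg K / k} U (fglift f) (lift_is_additive f).

Lemma fglift_linear (K : choiceType) (U : lmodType k) (f : K -> U) :
  linear (fglift f).
Proof.
have fgZ c D : fglift f (c *: D) = c *: fglift f D.
  have fgU : forall a x, fglift f (c *: << a *g x >>) = c *: fglift f << a *g x >>.
    move=> a x; have -> : c *: << a *g x >> = << c * a *g x >> :> {freeg K / k}.
      by apply/eqP/freeg_eqP => y; rewrite coeffZ !coeffU mulrA.
    by rewrite !liftU scalerA.
  rewrite -(freeg_sumE D); elim/big_rec: _ => [|i y _ IH].
    by rewrite scaler0 raddf0 scaler0.
  by rewrite !raddfD /= IH fgU.
by move=> c u v; rewrite raddfD /= fgZ.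
Qed.
HB.instance Definition _ (K : choiceType) (U : lmodType k) (f : K -> U) :=
  GRing.isLinear.Build k {freeg K / k} U _ (fglift f) (fglift_linear f).

Section Lift.
Context {V W U : lmodType k} (f : V -> W -> U) (fL : bilinear f).

Let f1 (p : V * W) : U := f p.1 p.2.

Lemma tlift_subproof x : tens_rel x -> fglift f1 x = 0.
Proof.
case=> [[c][u][v][w]->|[c][v][u][w]->].
  by rewrite linearB linearP /= !liftU !scale1r /f1 /= fL.1 subrr.
by rewrite linearB linearP /= !liftU !scale1r /f1 /= fL.2 subrr.
Qed.

Definition tlift : tens V W -> U := qlift tlift_subproof \o @untens V W.
HB.instance Definition _ :=
  GRing.Linear.copy tlift (qlift tlift_subproof \o @untens V W).

Lemma tliftE v w : tlift (v ⊗ w) = f v w.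
Proof. by apply: etrans (qliftE _ _) _; rewrite /= liftU scale1r. Qed.

End Lift.

Lemma tens_ind (V W : lmodType k) (P : tens V W -> Prop) :
  P 0 -> (forall c x y, P x -> P y -> P (c *: x + y)) ->
  (forall v w, P (v ⊗ w)) -> forall x, P x.
Proof.
move=> P0 PD Pp [x]; have [D <-] := qproj_surj x.
rewrite -[D]freeg_sumE linear_sum.
elim/big_rec: _ => [//|[v w] y _ Py].
have -> : << coeff (v, w) D *g (v, w) >> =
    coeff (v, w) D *: << (v, w) >> :> {freeg (V * W) / k}.
  by apply/eqP/freeg_eqP => z; rewrite coeffZ !coeffU mul1r.
rewrite linearZZ; exact: (PD _ _ _ (Pp v w) Py).
Qed.

Lemma tens_ext (V W U : lmodType k) (f g : {linear tens V W -> U}) :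
  (forall v w, f (v ⊗ w) = g (v ⊗ w)) -> f =1 g.
Proof.
move=> fg; elim/tens_ind => [|c x y Ex Ey|//]; first by rewrite !linear0.
by rewrite !linearP Ex Ey.
Qed.

Section Maps.
Context {U V W X : lmodType k}.

Fact tmap_bilinear (f : {linear U -> W}) (g : {linear V -> X}) :
  bilinear (fun u v => f u ⊗ g v).
Proof.
by split=> [v|u] c a b; rewrite linearP ?(tpure_bilinear W X).1
  ?(tpure_bilinear W X).2.
Qed.
Definition tmap (f : {linear U -> W}) (g : {linear V -> X}) :
  tens U V -> tens W X := tlift (tmap_bilinear f g).
HB.instance Definition _ f g :=
  GRing.Linear.copy (tmap f g) (tlift (tmap_bilinear f g)).

Lemma tmapE f g u v : tmap f g (u ⊗ v) = f u ⊗ g v.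
Proof. exact: tliftE. Qed.

Fact tswap_bilinear : bilinear (fun (u : U) (v : V) => v ⊗ u).
Proof.
by split=> [v|u] c a b; rewrite ?(tpure_bilinear V U).1 ?(tpure_bilinear V U).2.
Qed.
Definition tswap : tens U V -> tens V U := tlift tswap_bilinear.
HB.instance Definition _ := GRing.Linear.copy tswap (tlift tswap_bilinear).

Lemma tswapE u v : tswap (u ⊗ v) = v ⊗ u.
Proof. exact: tliftE. Qed.

Fact tscale_bilinear : bilinear (fun (v : V) (c : k^o) => (c : k) *: v).
Proof.
split=> [c|v] a u w /=; first by rewrite scalerDr !scalerA mulrC.
by rewrite scalerDl scalerA.
Qed.
Definition tscale : tens V k^o -> V := tlift tscale_bilinear.
HB.instance Definition _ := GRing.Linear.copy tscale (tlift tscale_bilinear).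

Lemma tscaleE v c : tscale (v ⊗ c) = c *: v.
Proof. exact: tliftE. Qed.

End Maps.

Section Associativity.
Context {U V W : lmodType k}.

Fact tassoc_bilinear :
  bilinear (fun (x : tens U V) (w : W) => tmap idfun (tpurer w) x).
Proof.
split=> [w|x] c a b; first by rewrite linearP.
elim/tens_ind: x => [|d x y Ex Ey|u v]; first by rewrite /= !linear0 addr0.
  by rewrite !(linearP (tmap _ _)) /= Ex Ey !scalerDr !scalerA [d * c]mulrC addrACA.
by rewrite !tmapE /= /tpurel /tpurer (tpure_bilinear V W).2 (tpure_bilinear U _).2.
Qed.
Definition tassoc : tens (tens U V) W -> tens U (tens V W) :=
  tlift tassoc_bilinear.
HB.instance Definition _ := GRing.Linear.copy tassoc (tlift tassoc_bilinear).

Lemma tassocE u v w : tassoc ((u ⊗ v) ⊗ w) = u ⊗ (v ⊗ w).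
Proof. by rewrite /tassoc tliftE tmapE. Qed.

Fact tassocV_bilinear :
  bilinear (fun (u : U) (y : tens V W) => tmap (tpurel u) idfun y).
Proof.
split=> [y|u] c a b; last by rewrite linearP.
elim/tens_ind: y => [|d x y Ex Ey|v w]; first by rewrite /= !linear0 addr0.
  by rewrite !(linearP (tmap _ _)) /= Ex Ey !scalerDr !scalerA [d * c]mulrC addrACA.
by rewrite !tmapE /= /tpurel /tpurer (tpure_bilinear U V).1 (tpure_bilinear _ W).1.
Qed.
Definition tassocV : tens U (tens V W) -> tens (tens U V) W :=
  tlift tassocV_bilinear.
HB.instance Definition _ := GRing.Linear.copy tassocV (tlift tassocV_bilinear).

Lemma tassocVE u v w : tassocV (u ⊗ (v ⊗ w)) = (u ⊗ v) ⊗ w.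
Proof. by rewrite /tassocV tliftE tmapE. Qed.

End Associativity.

Definition tmid {U V W X : lmodType k} :
    tens (tens U V) (tens W X) -> tens (tens U W) (tens V X) :=
  tassocV \o tmap idfun (tassoc \o (tmap tswap idfun \o tassocV)) \o tassoc.
HB.instance Definition _ (U V W X : lmodType k) :=
  GRing.Linear.copy (@tmid U V W X)
    (tassocV \o tmap idfun (tassoc \o (tmap tswap idfun \o tassocV)) \o tassoc).

Lemma tmidE (U V W X : lmodType k) (u : U) (v : V) (w : W) (x : X) :
  tmid ((u ⊗ v) ⊗ (w ⊗ x)) = (u ⊗ w) ⊗ (v ⊗ x).
Proof. by rewrite /tmid /= tassocE tmapE /= tassocVE tmapE /= tswapE tassocE tassocVE. Qed.

Fact tmult_bilinear (A : algType k) : bilinear (fun a b : A => a * b).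
Proof.
split=> [b|a] c u v; first by rewrite /= mulrDl scalerAl.
by rewrite /= mulrDr scalerAr.
Qed.
Definition tmult {A : algType k} : tens A A -> A := tlift (@tmult_bilinear A).
HB.instance Definition _ (A : algType k) :=
  GRing.Linear.copy (@tmult A) (tlift (@tmult_bilinear A)).

Lemma tmultE (A : algType k) (a b : A) : tmult (a ⊗ b) = a * b.
Proof. exact: tliftE. Qed.

Section Algebra.
Context {A B : algType k}.
Implicit Types x y z : tens A B.

Definition tmul x y : tens A B := tmap tmult tmult (tmid (x ⊗ y)).

Lemma tmulE (a c : A) (b d : B) : tmul (a ⊗ b) (c ⊗ d) = (a * c) ⊗ (b * d).
Proof. by rewrite /tmul tmidE tmapE /= !tmultE. Qed.

Lemma tmul_bilinear : bilinear tmul.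
Proof.
split=> [y|x] c a b; rewrite /tmul; last first.
  by rewrite (tpure_bilinear (tens A B) (tens A B)).2 !linearP.
by rewrite (tpure_bilinear (tens A B) (tens A B)).1 !linearP.
Qed.

Let tmul0r x : tmul x 0 = 0.
Proof. by rewrite /tmul -[x ⊗ 0]/(tpurel x 0) !linear0. Qed.
Let tmul0l x : tmul 0 x = 0.
Proof. by rewrite /tmul -[0 ⊗ x]/(tpurer x 0) !linear0. Qed.

Lemma tmulA : associative tmul.
Proof.
move=> x y z; elim/tens_ind: x => [|d x x' Ex Ey|a b]; first by rewrite /= !tmul0l.
  by rewrite !tmul_bilinear.1 Ex Ey.
elim/tens_ind: y => [|d x x' Ex Ey|a' b']; first by rewrite /= tmul0l tmul0r tmul0l.
  by rewrite !(tmul_bilinear.1, tmul_bilinear.2) Ex Ey.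
elim/tens_ind: z => [|d x x' Ex Ey|a'' b'']; first by rewrite /= !tmul0r.
  by rewrite !(tmul_bilinear.1, tmul_bilinear.2) Ex Ey.
by rewrite !tmulE !mulrA.
Qed.

Lemma tmul1l : left_id (1 ⊗ 1) tmul.
Proof.
move=> x; elim/tens_ind: x => [|d x x' Ex Ey|a b]; last by rewrite tmulE !mul1r.
  by rewrite /= tmul0r.
by rewrite tmul_bilinear.2 Ex Ey.
Qed.

Lemma tmul1r : right_id (1 ⊗ 1) tmul.
Proof.
move=> x; elim/tens_ind: x => [|d x x' Ex Ey|a b]; last by rewrite tmulE !mulr1.
  by rewrite /= tmul0l.
by rewrite tmul_bilinear.1 Ex Ey.
Qed.

Lemma tmulDl : left_distributive tmul +%R.
Proof. by move=> x y z; have := tmul_bilinear.1 z 1 x y; rewrite /= !scale1r. Qed.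

Lemma tmulDr : right_distributive tmul +%R.
Proof. by move=> x y z; have := tmul_bilinear.2 x 1 y z; rewrite /= !scale1r. Qed.

HB.instance Definition _ := GRing.Zmodule_isPzRing.Build (tens A B)
  tmulA tmul1l tmul1r tmulDl tmulDr.

End Algebra.

Definition stens {V W : lmodType k} (S : set V) (T : set W) : set (tens V W) :=
  span [set v ⊗ w | v in S & w in T].

End Tensor.

Notation "v ⊗ w" := (tpure v w) : ring_scope.

HB.mixin Record Algebra_isHopf (k : fieldType) H of GRing.Algebra k H := {
  comul : {linear H -> tens H H};
  counit : {linear H -> k^o};
  antip : {linear H -> H};
  comul1 : comul 1 = 1;
  comulM : {morph comul : x y / x * y};
  counit1 : counit 1 = 1;
  counitM : {morph counit : x y / x * y};
  comulA : forall x,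
    tassoc (tmap comul idfun (comul x)) = tmap idfun comul (comul x);
  comul_counitr : forall x, tscale (tmap idfun counit (comul x)) = x;
  comul_counitl : forall x, tscale (tswap (tmap counit idfun (comul x))) = x;
  antipl : forall x, tmult (tmap antip idfun (comul x)) = counit x *: 1;
  antipr : forall x, tmult (tmap idfun antip (comul x)) = counit x *: 1
}.

#[short(type="hopfAlgType")]
HB.structure Definition Hopf (k : fieldType) :=
  {H of GRing.Algebra k H & Algebra_isHopf k H}.

Section HopfTheory.
Context {k : fieldType}.

Definition subcoalgebra {H : hopfAlgType k} (C : set H) : Prop :=
  subspace C /\ forall x, C x -> stens C C (comul x).

Definition simple_subcoalgebra {H : hopfAlgType k} (C : set H) : Prop :=
  [/\ subcoalgebra C, C <> [set 0] &
      forall D, subcoalgebra D -> D `<=` C -> D = [set 0] \/ D = C].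

(* H equals its coradical; a sum of simple subcoalgebras is automatically
   a direct sum of some of them. *)
Definition cosemisimple (H : hopfAlgType k) : Prop :=
  span (\bigcup_(C in @simple_subcoalgebra H) C) = [set: H].

(* Stability under the antipode is S(L) <= L, as opposed to S(L) = L. *)
Definition hopf_subalgebra {H : hopfAlgType k} (L : set H) : Prop :=
  [/\ subcoalgebra L, L 1, forall x y, L x -> L y -> L (x * y) &
      forall x, L x -> L (antip x)].

Definition hopf_morphism {L H : hopfAlgType k} (f : {lrmorphism L -> H}) : Prop :=
  [/\ forall x, comul (f x) = tmap f f (comul x),
      forall x, counit (f x) = counit x &
      forall x, antip (f x) = f (antip x)].

(* Ad_R h = h_(2) ⊗ S(h_(1)) h_(3) *)
Definition Ad_R {H : hopfAlgType k} (h : H) : tens H H :=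
  tmap idfun (tmult \o tmap antip idfun)
    (tassoc (tmap tswap idfun (tmap comul idfun (comul h)))).

End HopfTheory.

Section Calculus.
Context {k : fieldType}.

Record bimodule (A : algType k) := Bimodule {
  bimod_sort :> lmodType k;
  lact : A -> bimod_sort -> bimod_sort;
  ract : bimod_sort -> A -> bimod_sort;
  lact_bilinear : bilinear lact;
  ract_bilinear : bilinear ract;
  lact1 : forall w, lact 1 w = w;
  lactM : forall a b w, lact (a * b) w = lact a (lact b w);
  ract1 : forall w, ract w 1 = w;
  ractM : forall w a b, ract w (a * b) = ract (ract w a) b;
  lractA : forall a w b, ract (lact a w) b = lact a (ract w b)
}.

Record fodc (A : algType k) := Fodc {
  fodc_bimod :> bimodule A;
  diff : {linear A -> fodc_bimod};
  diffM : forall a b, diff (a * b) = ract (diff a) b + lact a (diff b);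
  diff_gen : span [set w | exists a b, w = lact a (diff b)] = [set: fodc_bimod]
}.

Section Fodc.
Context {A : algType k} (Omega : fodc A).

Fact ldiff_bilinear : bilinear (fun a b => lact a (diff Omega b)).
Proof.
split=> [b|a] c u v /=; first by rewrite (lact_bilinear Omega).1.
by rewrite linearP (lact_bilinear Omega).2.
Qed.

Definition ldiff : tens A A -> Omega := tlift ldiff_bilinear.
HB.instance Definition _ := GRing.Linear.copy ldiff (tlift ldiff_bilinear).

(* On the universal calculus ker(A ⊗ A -> A), ldiff is the projection
   sum a d_u b |-> sum a d b onto Omega; fodc_ker is its kernel N. *)
Definition universal_fodc : set (tens A A) := [set x | tmult x = 0].
Definition fodc_ker : set (tens A A) :=
  [set x | universal_fodc x /\ ldiff x = 0].

End Fodc.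
End Calculus.

Section Coaction.
Context {k : fieldType} {H : hopfAlgType k} {A : algType k}.
Implicit Types (delta : {linear A -> tens A H}) (I : set A) (L : set H).

Record comodule_algebra delta : Prop := ComoduleAlgebra {
  coactA : forall a,
    tassoc (tmap delta idfun (delta a)) = tmap idfun comul (delta a);
  coact_counit : forall a, tscale (tmap idfun counit (delta a)) = a;
  coact1 : delta 1 = 1;
  coactM : {morph delta : a b / a * b}
}.

Definition coinvariants delta : set A := [set a | delta a = a ⊗ 1].

Fact ver_bilinear delta : bilinear (fun a b => (a ⊗ 1 : tens A H) * delta b).
Proof.
split=> [b|a] c u v /=; last by rewrite linearP [LHS](@tmul_bilinear k A H).2.
by rewrite (tpure_bilinear A H).1 [LHS](@tmul_bilinear k A H).1.
Qed.

(* a ⊗ b |-> a b_(0) ⊗ b_(1) on all of A ⊗ A: its restriction to the universal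
   calculus is ver, and it induces can on A ⊗_B A. *)
Definition ver delta : tens A A -> tens A H := tlift (ver_bilinear delta).
HB.instance Definition _ delta :=
  GRing.Linear.copy (ver delta) (tlift (ver_bilinear delta)).

Definition balanced (B : set A) : set (tens A A) :=
  [set x | exists a b c, B b /\ x = (a * b) ⊗ c - a ⊗ (b * c)].

Definition tensB (B : set A) : Type := quotv (balanced B).
HB.instance Definition _ B := GRing.Lmodule.on (tensB B).

Fact can_subproof delta : comodule_algebra delta ->
  forall x, balanced (coinvariants delta) x -> ver delta x = 0.
Proof.
move=> dA _ [a [b [c [Bb ->]]]]; rewrite linearB /= /ver !tliftE (coactM dA) Bb.
by rewrite mulrA [X in _ - X * _]tmulE mul1r subrr.
Qed.

Definition can delta (dA : comodule_algebra delta) :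
    tensB (coinvariants delta) -> tens A H :=
  qlift (can_subproof dA).

(* a d b |-> a_(0) d b_(0) ⊗ a_(1) b_(1) is a well defined linear map *)
Definition covariant (Omega : fodc A) delta : Prop :=
  exists Delta_R : {linear Omega -> tens Omega H}, forall a b : A,
    Delta_R (lact a (diff Omega b)) =
      tmap (ldiff Omega) tmult (tmid (delta a ⊗ delta b)).

Definition hopf_image delta L : Prop :=
  [/\ hopf_subalgebra L, forall a, stens setT L (delta a) &
      forall L', hopf_subalgebra L' -> (forall a, stens setT L' (delta a)) ->
        L `<=` L'].

Definition inner_faithful delta : Prop := hopf_image delta [set: H].

Definition two_sided_ideal I : Prop :=
  subspace I /\ forall a x, I x -> I (a * x) /\ I (x * a).

Definition proper_stable_ideal delta I : Prop :=
  [/\ two_sided_ideal I, ~ I 1 & forall x, I x -> stens I setT (delta x)].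

(* The unit ideal is always stable, and an algType is nontrivial, so that A / I
   is an algebra only for proper I.  A largest proper stable ideal, when there
   is one, is the unique maximal one (see largest_maximal); maximal ones always
   exist by Zorn. *)
Definition maximal_stable_ideal delta I : Prop :=
  proper_stable_ideal delta I /\
  forall J, proper_stable_ideal delta J -> I `<=` J -> J = I.

Lemma largest_maximal delta I : proper_stable_ideal delta I ->
  (forall J, proper_stable_ideal delta J -> J `<=` I) ->
  forall J, maximal_stable_ideal delta J <-> J = I.
Proof.
move=> sI maxI J; split=> [[sJ maxJ]|->].
  by rewrite (maxJ I sI (maxI J sJ)).
by split=> // K sK IK; apply/seteqP; split=> //; apply: maxI.
Qed.

End Coaction.

Section Bundle.
Context {k : fieldType}.

Definition right_ideal {H : hopfAlgType k} (Q : set H) : Prop :=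
  subspace Q /\ forall q h, Q q -> Q (q * h).

(* Hopf algebras are required to have a bijective antipode. *)
Record quantum_principal_bundle {A : algType k} (Omega : fodc A)
    {H : hopfAlgType k} (delta : {linear A -> tens A H}) : Prop :=
  QuantumPrincipalBundle {
  qpb_antip : bijective (@antip k H);
  qpb_comodule : comodule_algebra delta;
  qpb_covariant : covariant Omega delta;
  qpb_can : bijective (can qpb_comodule);
  qpb_ver : exists Q : set H,
    [/\ right_ideal Q, forall q, Q q -> counit q = 0,
        forall q, Q q -> stens Q setT (Ad_R q) &
        ver delta @` fodc_ker Omega = stens setT Q]
}.

Definition calculus_relations {A : algType k} (Omega : fodc A) (I : set A) :
    set Omega :=
  span ([set w | exists i v, I i /\ w = lact i v] `|`
        [set w | exists i v, I i /\ w = ract v i] `|`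
        [set w | exists a i b, I i /\ w = ract (lact a (diff Omega i)) b]).

Arguments calculus_relations {A} Omega I _.

(* (A0, Omega0) with the projections pi and p is (A / I, Omega / relations). *)
Definition quotient_calculus {A A0 : algType k} (Omega : fodc A) (I : set A)
    (pi : {lrmorphism A -> A0}) (Omega0 : fodc A0) : Prop :=
  exists p : {linear Omega -> Omega0},
    [/\ forall w, exists v, p v = w,
        forall v, p v = 0 <-> calculus_relations Omega I v,
        forall a v, p (lact a v) = lact (pi a) (p v),
        forall v a, p (ract v a) = ract (p v) (pi a) &
        forall a, diff Omega0 (pi a) = p (diff Omega a)].

(* The reduction is specified up to isomorphism: the Hopf image is presented by
   an injective Hopf algebra map iota, the quotient algebra by a surjection pi
   with kernel I. *)
Definition hopf_image_reduction {A : algType k} (Omega : fodc A)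
    {H : hopfAlgType k} (delta : {linear A -> tens A H})
    {A0 : algType k} (Omega0 : fodc A0)
    {L : hopfAlgType k} (delta0 : {linear A0 -> tens A0 L}) : Prop :=
  exists (iota : {lrmorphism L -> H}) (delta_im : {linear A -> tens A L})
         (I : set A) (pi : {lrmorphism A -> A0}),
    [/\ [/\ injective iota, hopf_morphism iota & hopf_image delta (range iota)],
        forall a, tmap idfun iota (delta_im a) = delta a,
        maximal_stable_ideal delta_im I,
        (forall b, exists a, pi a = b) /\ (forall a, pi a = 0 <-> I a) &
        (forall a, delta0 (pi a) = tmap pi idfun (delta_im a)) /\
        quotient_calculus Omega I pi Omega0].

End Bundle.

(* Main.v *)
(** Surjectivity of the canonical map forces the coefficient space of the
    coaction to be all of H: if delta(A) lies in A ⊗ L, then so does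
    A ⊗ H = can(A ⊗_B A), and a linear functional on A with value 1 at 1 gives
    L = H.  So the Hopf image is H itself, and the reduction only passes to the
    quotient pi : A -> A/I by a delta-stable ideal.

    Bijectivity of can descends because the kernel I ⊗ H of pi ⊗ id is
    can(I ⊗_B A).  The calculus descends because every relation divided out of
    Omega comes from an element of ker(pi ⊗ pi); hence the sub-bimodule N_0 of
    the quotient is (pi ⊗ pi)(N), and ver(N_0) = (pi ⊗ id)(A ⊗ Q) = A_0 ⊗ Q for
    the same right ideal Q. *)

Require Import Defs.
From HB Require Import structures.
From mathcomp Require Import all_boot all_algebra.
From mathcomp Require Import sesquilinear.
From mathcomp Require Import boolp classical_sets.

Set Implicit Arguments.
Unset Strict Implicit.
Unset Printing Implicit Defensive.

Import Defs GRing.Theory.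

Local Open Scope ring_scope.

(** * Zorn's lemma for nonempty chains of sets *)

Section Zorn.
Local Open Scope classical_set_scope.

(* [Zorn_bigcup] also asks for the union of the empty chain, hence the
   detour through [S = set0 \/ P S]. *)
Lemma Zorn_bigcup_nonempty (T : Type) (P : set (set T)) (S0 : set T) :
  P S0 -> S0 !=set0 ->
  (forall F : set (set T), F !=set0 -> F `<=` P -> total_on F subset ->
     P (\bigcup_(X in F) X)) ->
  exists S, P S /\ forall S', P S' -> S `<=` S' -> S' = S.
Proof.
move=> PS0 S0n0 chP.
have [|S [/= [S_0|PS] Smax]] := @Zorn_bigcup T [set S | S = set0 \/ P S].
- move=> F FP Ft /=; have [[S [FS Sn0]]|F0] :=
    pselect (exists S, F S /\ S !=set0); last first.
    left; apply/seteqP; split=> // x [S FS Sx].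
    by case: F0; exists S; split=> //; exists x.
  (* Dropping the empty members leaves the union unchanged, and every remaining member satisfies
     [P]. *)
  right; pose G := [set S | F S /\ S !=set0].
  have -> : \bigcup_(X in F) X = \bigcup_(X in G) X.
    apply/seteqP; split=> x [X FX Xx]; last by exists X => //; case: FX.
    by exists X => //; split=> //; exists x.
  apply: chP => [|X [FX [x Xx]]|X Y [FX _] [FY _]]; last exact: Ft.
    by exists S.
  by have [X0|//] := FP X FX; rewrite X0 in Xx.
- exfalso; apply: (Smax S0); last by right.
  rewrite S_0; split=> // S0s; have [x /S0s//] := S0n0.
exists S; split=> // S' PS' SS'; apply/seteqP; split=> //.
by apply: contrapT => nS; apply: (Smax S'); [split|right].
Qed.

End Zorn.

(** * Subspaces, and linear functionals normalized at a vector *)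

Section Subspaces.
Local Open Scope classical_set_scope.
Context {k : fieldType}.
Implicit Types V W U : lmodType k.

Lemma subspaceD V (S : set V) u v : subspace S -> S u -> S v -> S (u + v).
Proof. by move=> sS Su Sv; rewrite -[u]scale1r; apply: sS.2. Qed.

Lemma subspaceZ V (S : set V) (c : k) v : subspace S -> S v -> S (c *: v).
Proof. by move=> sS Sv; rewrite -[_ *: _]addr0; apply: sS.2 => //; apply: sS.1. Qed.

Lemma subspaceB V (S : set V) u v : subspace S -> S u -> S v -> S (u - v).
Proof. by move=> sS Su Sv; rewrite addrC -scaleN1r; apply: sS.2. Qed.

Lemma subspaceT V : subspace [set: V]. Proof. by []. Qed.

Lemma subspace0 V : subspace [set (0 : V)].
Proof. by split=> // c u v -> ->; rewrite /= scaler0 addr0. Qed.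

Lemma subspace_preim V W (f : {linear V -> W}) (S : set W) :
  subspace S -> subspace (f @^-1` S).
Proof.
move=> sS; split=> [|c u v fu fv]; rewrite /preimage /= ?linear0 ?linearP.
  exact: sS.1.
exact: sS.2.
Qed.

Lemma subspace_image V W (f : {linear V -> W}) (S : set V) :
  subspace S -> subspace (f @` S).
Proof.
move=> sS; split=> [|c _ _ [u Su <-] [v Sv <-]].
  by exists 0; [exact: sS.1|rewrite linear0].
by exists (c *: u + v); [exact: sS.2|rewrite linearP].
Qed.

Lemma subspace_bigcup V (F : set (set V)) : F !=set0 -> total_on F subset ->
  (forall S, F S -> subspace S) -> subspace (\bigcup_(S in F) S).
Proof.
move=> [S0 FS0] Ft Fs; split=> [|c u v [S FS Su] [T FT Tv]].
  by exists S0; [|exact: (Fs _ FS0).1].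
have [ST|TS] := Ft _ _ FS FT.
  by exists T => //; apply: (Fs _ FT).2 => //; apply: ST.
by exists S => //; apply: (Fs _ FS).2 => //; apply: TS.
Qed.

Lemma span_id V (S : set V) : subspace S -> span S = S.
Proof. by move=> sS; apply/seteqP; split; [apply: span_min|apply: span_gen]. Qed.

Lemma qproj_eq0P V (X : set V) v : qproj X v = 0 <-> span X v.
Proof. by rewrite -(linear0 (qproj X)) qproj_eqP subr0. Qed.

(** A subspace [S] maximal among those avoiding [v] is a complement of the line through [v]; [phi w]
    is the coefficient of [v] in [w] modulo [S], unique because [v] is not in [S]. *)
Lemma linear_functional V (v : V) : v <> 0 ->
  exists phi : {linear V -> k^o}, phi v = 1.
Proof.
move=> vn0; pose P : set (set V) := [set S | subspace S /\ ~ S v].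
have [|||S [[sS Sv] Smax]] := @Zorn_bigcup_nonempty V P [set 0].
- by split; [exact: subspace0|].
- by exists 0.
- move=> F Fn0 FP Ft; split; last by case=> S /FP[].
  by apply: subspace_bigcup => // S /FP[].
have ex w : exists c : k, S (w - c *: v).
  have [Sw|nSw] := pselect (S w); first by exists 0; rewrite scale0r subr0.
  (* [S'] is [S] plus the line through [w]. Maximality puts [v] in it, so [v - c *: w] lies in [S]
     with [c] nonzero, and dividing by [c] expresses [w] modulo [S] as a multiple of [v]. *)
  pose S' := [set x | exists c : k, S (x - c *: w)].
  have S'v : S' v.
    apply: contrapT => nS'v; apply: nSw; rewrite -(Smax S').
    - by exists 1; rewrite scale1r subrr; apply: sS.1.
    - split=> //; split=> [|c x y [a Sx] [b Sy]].
        by exists 0; rewrite scale0r subr0; apply: sS.1.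
      exists (c * a + b); rewrite scalerDl -scalerA opprD addrACA -scalerBr.
      exact: sS.2.
    - by move=> x Sx; exists 0; rewrite scale0r subr0.
  have [c Sc] := S'v; have [c0|cn0] := eqVneq c 0.
    by case: Sv; rewrite c0 scale0r subr0 in Sc.
  exists c^-1; have := subspaceZ (- c^-1) sS Sc.
  by rewrite scalerBr scalerA mulNr mulVf // !scaleNr scale1r opprK addrC.
have [phi phiP] := choice ex.
have uniq w a b : S (w - a *: v) -> S (w - b *: v) -> a = b.
  move=> Sa Sb; apply/eqP; rewrite -subr_eq0; apply/eqP.
  apply: contrapT => /eqP abn0; apply: Sv.
  have := subspaceZ (a - b)^-1 sS (subspaceB sS Sb Sa).
  by rewrite opprB [_ - _ + _]addrC addrA subrK -scalerBl scalerA mulVf // scale1r.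
have phiL : linear (phi : V -> k^o).
  move=> c x y; apply: (uniq (c *: x + y)) => //.
  suff: S (c *: x + y - (c * phi x + phi y) *: v) by [].
  rewrite scalerDl -scalerA opprD addrACA -scalerBr.
  exact: sS.2.
exists (HB.pack_for {linear V -> k^o} (phi : V -> k^o)
  (GRing.isLinear.Build k V k^o *:%R phi phiL)).
by apply: (uniq v) => //=; rewrite scale1r subrr; apply: sS.1.
Qed.

End Subspaces.

(** * Subspaces of tensor products and kernels of tensor maps *)

Section TensorSets.
Local Open Scope classical_set_scope.
Context {k : fieldType}.
Implicit Types V W U X : lmodType k.

Lemma tpure0l V W (w : W) : (0 : V) ⊗ w = 0.
Proof. exact: (linear0 (tpurer w)). Qed.

Lemma tpure0r V W (v : V) : v ⊗ (0 : W) = 0.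
Proof. exact: (linear0 (tpurel v)). Qed.

Lemma tpureBl V W (v v' : V) (w : W) : (v - v') ⊗ w = v ⊗ w - v' ⊗ w.
Proof. exact: (linearB (tpurer w)). Qed.

Lemma tmap_comp U V W X U' V' (f : {linear W -> U'}) (g : {linear X -> V'})
    (f' : {linear U -> W}) (g' : {linear V -> X}) x :
  tmap f g (tmap f' g' x) = tmap (f \o f') (g \o g') x.
Proof.
elim/(@tens_ind k): x => [|c x y IHx IHy|u v]; first by rewrite !linear0.
  by rewrite !linearP /= IHx IHy.
by rewrite !tmapE.
Qed.

Lemma eq_tmap U V W X (f f' : {linear U -> W}) (g g' : {linear V -> X}) :
  f =1 f' -> g =1 g' -> tmap f g =1 tmap f' g'.
Proof. by move=> ff' gg'; apply: tens_ext => u v; rewrite /= !tmapE ff' gg'. Qed.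

Lemma tmap_id V W (f : {linear V -> V}) (g : {linear W -> W}) :
  f =1 id -> g =1 id -> tmap f g =1 id.
Proof.
move=> f1 g1; elim/(@tens_ind k) => [|c x y IHx IHy|u v]; first by rewrite linear0.
  by rewrite !linearP /= IHx IHy.
by rewrite tmapE f1 g1.
Qed.

Lemma stens_subspace V W (S : set V) (T : set W) : subspace (stens S T).
Proof. exact: span_subspace. Qed.

Lemma stens_pure V W (S : set V) (T : set W) v w :
  S v -> T w -> stens S T (v ⊗ w).
Proof. by move=> Sv Tw; apply: span_gen; exists v => //; exists w. Qed.

Lemma stens_min V W (S : set V) (T : set W) (M : set (tens V W)) :
  subspace M -> (forall v w, S v -> T w -> M (v ⊗ w)) -> stens S T `<=` M.
Proof. by move=> sM ST; apply: span_min => // _ [v Sv [w Tw <-]]; apply: ST. Qed.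

Lemma stens_setT V W : stens [set: V] [set: W] = setT.
Proof.
apply/seteqP; split=> // x _; elim/(@tens_ind k): x => [|c x y|v w].
- exact: (stens_subspace _ _).1.
- exact: (stens_subspace _ _).2.
- exact: stens_pure.
Qed.

Lemma stens_tmap V W U X (f : {linear V -> U}) (g : {linear W -> X})
    (S : set V) (T : set W) (S' : set U) (T' : set X) :
  (forall v, S v -> S' (f v)) -> (forall w, T w -> T' (g w)) ->
  forall x, stens S T x -> stens S' T' (tmap f g x).
Proof.
move=> fS gT; apply: stens_min; first exact: subspace_preim (stens_subspace _ _).
by move=> v w Sv Tw; rewrite /preimage /= tmapE; apply: stens_pure; auto.
Qed.

Lemma subset_stens V W (S S' : set V) (T T' : set W) :
  S `<=` S' -> T `<=` T' -> stens S T `<=` stens S' T'.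
Proof.
move=> SS' TT'; apply: stens_min; first exact: stens_subspace.
by move=> v w /SS' Sv /TT' Tw; apply: stens_pure.
Qed.

(** Passing to the quotient by [T] in the second factor kills [v ⊗ w]; contracting the first factor
    with a functional equal to 1 at [v] then leaves the class of [w], which must vanish. *)
Lemma tpure_stens V W (v : V) (T : set W) w : v <> 0 -> subspace T ->
  stens setT T (v ⊗ w) -> T w.
Proof.
move=> vn0 sT vwT; rewrite -(span_id sT); apply/qproj_eq0P.
have : tmap idfun (qproj T) (v ⊗ w) = 0.
  apply: (stens_min _ _ vwT (M := [set x | tmap idfun (qproj T) x = 0])).
    exact: subspace_preim (subspace0 _).
  move=> u w' _ Tw' /=; have Tw'0 : qproj T w' = 0.
    by apply/qproj_eq0P; apply: span_gen.
  by rewrite tmapE /= Tw'0 tpure0r.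
rewrite tmapE /= => vw0; have [phi phi1] := linear_functional vn0.
have := congr1 (fun x => tscale (tswap (tmap phi idfun x))) vw0.
by rewrite /= tmapE tswapE tscaleE phi1 scale1r !linear0.
Qed.

(** Right exactness of the tensor product: the projection [q] modulo [K ⊗ W] factors through
    [tmap f idfun], so whatever the latter kills is zero modulo [K ⊗ W]. *)
Lemma tmap_ker V U W (f : {linear V -> U}) (x : tens V W) :
  (forall u, exists v, f v = u) -> tmap f idfun x = 0 ->
  stens [set v | f v = 0] setT x.
Proof.
move=> f_surj; set K := [set v | f v = 0]; have [s fs] := choice f_surj.
pose q : {linear _ -> _} := qproj (stens K [set: W]).
have qf v v' w : f v = f v' -> q (v ⊗ w) = q (v' ⊗ w).
  move=> fvv'; apply/qproj_eqP; rewrite -tpureBl; apply: span_gen.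
  by apply: stens_pure => //; rewrite /K /= linearB fvv' subrr.
(* The section [s] is only a function. Additivity in [u] comes from [qf], by which [q (v ⊗ w)]
   depends on [v] only through [f v]. *)
have gL : bilinear_for *:%R *:%R (fun u w => q (s u ⊗ w)).
  split=> [w|u] c a b /=; last by rewrite (tpure_bilinear V W).2 linearP.
  rewrite (@qf _ (c *: s a + s b)); last by rewrite linearP !fs.
  by rewrite (tpure_bilinear V W).1 linearP.
have gE : forall y, tlift gL (tmap f idfun y) = q y.
  elim/(@tens_ind k) => [|c y z IHy IHz|v w]; first by rewrite !linear0.
    by rewrite !linearP /= IHy IHz.
  by rewrite tmapE tliftE; apply: qf; rewrite fs.
move=> fx0; rewrite -(span_id (stens_subspace _ _)); apply/qproj_eq0P.
by rewrite -[LHS]gE fx0 linear0.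
Qed.

End TensorSets.

(** * Naturality and multiplicativity of tensor maps *)

Section TensorMaps.
Local Open Scope classical_set_scope.
Context {k : fieldType}.
Implicit Types V W U X : lmodType k.
Implicit Types A B : algType k.

Lemma tmap_surj V W U X (f : {linear V -> U}) (g : {linear W -> X}) :
  (forall u, exists v, f v = u) -> (forall x, exists w, g w = x) ->
  forall z, exists y, tmap f g y = z.
Proof.
move=> fS gS; elim/(@tens_ind k) => [|c _ _ [x <-] [y <-]|u x].
- by exists 0; rewrite linear0.
- by exists (c *: x + y); rewrite linearP.
- by have [[v <-] [w <-]] := (fS u, gS x); exists (v ⊗ w); rewrite tmapE.
Qed.

Lemma tens_ext4 U V W X (Y : lmodType k)
    (f g : {linear tens (tens U V) (tens W X) -> Y}) :
  (forall u v w x, f ((u ⊗ v) ⊗ (w ⊗ x)) = g ((u ⊗ v) ⊗ (w ⊗ x))) -> f =1 g.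
Proof.
move=> fg; apply: tens_ext => y z.
apply: (tens_ext (f := f \o tpurer z) (g := g \o tpurer z)) => u v.
apply: (tens_ext (f := f \o tpurel (u ⊗ v)) (g := g \o tpurel (u ⊗ v))) => w x.
exact: fg.
Qed.

(** The factor is [g] composed with an arbitrary section of [f]; the inclusion of kernels makes the
    value independent of the section, hence linear. *)
Lemma linear_factor V U X (f : {linear V -> U}) (g : {linear V -> X}) :
  (forall u, exists v, f v = u) -> (forall v, f v = 0 -> g v = 0) ->
  exists h : {linear U -> X}, forall v, h (f v) = g v.
Proof.
move=> fS fg; have [s fs] := choice fS.
have gs v : g (s (f v)) = g v.
  by apply/eqP; rewrite -subr_eq0 -linearB fg // linearB /= fs subrr.
have hL : linear (g \o s).
  move=> c x y; rewrite -[x]fs -[y]fs -linearP /= !gs.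
  by rewrite linearP.
exists (HB.pack_for {linear U -> X} (g \o s)
  (GRing.isLinear.Build k U X *:%R (g \o s) hL)).
exact: gs.
Qed.

Lemma tassoc_tmap U V W U' V' W' (f : {linear U -> U'}) (g : {linear V -> V'})
    (h : {linear W -> W'}) x :
  tassoc (tmap (tmap f g) h x) = tmap f (tmap g h) (tassoc x).
Proof.
elim/(@tens_ind k): x => [|c x y IHx IHy|x w]; first by rewrite !linear0.
  by rewrite !linearP /= IHx IHy.
rewrite tmapE /=; elim/(@tens_ind k): x => [|c x y IHx IHy|u v].
- by rewrite linear0 !tpure0l !linear0.
- by rewrite linearP !(tpure_bilinear _ _).1 !linearP /= IHx IHy.
- by rewrite tmapE !tassocE !tmapE /= tmapE.
Qed.

Lemma tswap_tmap U V W X (f : {linear U -> W}) (g : {linear V -> X}) x :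
  tswap (tmap f g x) = tmap g f (tswap x).
Proof.
elim/(@tens_ind k): x => [|c x y IHx IHy|u v]; first by rewrite !linear0.
  by rewrite !linearP /= IHx IHy.
by rewrite tmapE !tswapE tmapE.
Qed.

Lemma tscale_tmap V W (f : {linear V -> W}) x :
  tscale (tmap f idfun x) = f (tscale x).
Proof.
elim/(@tens_ind k): x => [|c x y IHx IHy|v a]; first by rewrite !linear0.
  by rewrite !linearP /= IHx IHy.
by rewrite tmapE !tscaleE linearZ.
Qed.

Lemma tmult_tmap A B (f : {lrmorphism A -> B}) x :
  tmult (tmap f f x) = f (tmult x).
Proof.
elim/(@tens_ind k): x => [|c x y IHx IHy|a b]; first by rewrite !linear0.
  by rewrite !linearP /= IHx IHy.
by rewrite tmapE !tmultE rmorphM.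
Qed.

Lemma tpureM A B (a a' : A) (b b' : B) :
  (a ⊗ b : tens A B) * (a' ⊗ b') = (a * a') ⊗ (b * b').
Proof. exact: tmulE. Qed.

Lemma tmulP A B (z x y : tens A B) (c : k) :
  z * (c *: x + y) = c *: (z * x) + z * y.
Proof. exact: (@tmul_bilinear k A B).2. Qed.

Lemma tmulPl A B (z x y : tens A B) (c : k) :
  (c *: x + y) * z = c *: (x * z) + y * z.
Proof. exact: (@tmul_bilinear k A B).1. Qed.

Lemma tmap1 A B A' B' (f : {lrmorphism A -> A'}) (g : {lrmorphism B -> B'}) :
  tmap f g 1 = 1.
Proof. by rewrite [LHS]tmapE /= !rmorph1. Qed.

Lemma tmapM A B A' B' (f : {lrmorphism A -> A'}) (g : {lrmorphism B -> B'}) :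
  {morph tmap f g : x y / x * y}.
Proof.
move=> x y; elim/(@tens_ind k): x => [|c x x' IHx IHx'|a b].
- by rewrite mul0r !linear0 mul0r.
- by rewrite tmulPl !linearP /= tmulPl IHx IHx'.
elim/(@tens_ind k): y => [|c y y' IHy IHy'|a' b'].
- by rewrite mulr0 !linear0 mulr0.
- by rewrite tmulP !linearP /= tmulP IHy IHy'.
by rewrite !tmapE !tpureM tmapE /= !rmorphM.
Qed.

Lemma lrmorphism_inv A B (f : {lrmorphism A -> B}) : bijective f ->
  exists g : {lrmorphism B -> A}, cancel f g /\ cancel g f.
Proof.
case=> g fK gK.
exists (HB.pack_for {lrmorphism B -> A} g
  (GRing.isLinear.Build k B A *:%R g (can2_linear fK gK))
  (GRing.isMonoidMorphism.Build B A g (can2_monoid_morphism fK gK))).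
by [].
Qed.

End TensorMaps.

(** * Transport along Hopf algebra maps *)

Section HopfMorphisms.
Context {k : fieldType}.

Lemma hopf_morphism_inv (H L : hopfAlgType k) (f : {lrmorphism L -> H})
    (g : {lrmorphism H -> L}) : cancel f g -> cancel g f ->
  hopf_morphism f -> hopf_morphism g.
Proof.
move=> fK gK [fD fe fS]; split=> x; rewrite -[x in LHS]gK.
- rewrite fK -[x in RHS]gK fD tmap_comp tmap_id //; exact: fK.
- by rewrite -fe !gK.
- by rewrite -[in RHS](gK x) fS !fK.
Qed.

(** Each constituent of [Ad_R] (coproduct, swap, reassociation, antipode, product) is natural in
    [f], so [f] is pushed outwards one constituent at a time. This carries Ad-invariance of [Q] over
    to its image. *)
Lemma Ad_R_morphism (H L : hopfAlgType k) (f : {lrmorphism H -> L}) :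
  hopf_morphism f -> forall h, Ad_R (f h) = tmap f f (Ad_R h).
Proof.
move=> [fD _ fS] h.
have E1 x : tmap comul idfun (tmap f f x) = tmap (tmap f f) f (tmap comul idfun x).
  by rewrite !tmap_comp; apply: eq_tmap.
have E2 x : tmap tswap idfun (tmap (tmap f f) f x) =
    tmap (tmap f f) f (tmap tswap idfun x).
  by rewrite !tmap_comp; apply: eq_tmap => // y; apply: tswap_tmap.
have E3 x : tmap antip idfun (tmap f f x) = tmap f f (tmap antip idfun x).
  by rewrite !tmap_comp; apply: eq_tmap.
rewrite /Ad_R fD E1 E2 tassoc_tmap !tmap_comp; apply: eq_tmap => // x /=.
by rewrite E3 tmult_tmap.
Qed.

Lemma antip_bij_morphism (H L : hopfAlgType k) (f : {lrmorphism H -> L}) :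
  bijective f -> hopf_morphism f -> bijective (@antip k H) ->
  bijective (@antip k L).
Proof.
move=> [g fK gK] [_ _ fS] [s sK Ks]; exists (f \o s \o g) => x /=.
  by rewrite -{1}[x]gK fS fK sK gK.
by rewrite fS Ks gK.
Qed.

End HopfMorphisms.

(** * Consequences of bijectivity of the canonical map *)

Section Coactions.
Local Open Scope classical_set_scope.
Context {k : fieldType} {H : hopfAlgType k} {A : algType k}.
Context (delta : {linear A -> tens A H}).

Lemma ver_tpure a b : ver delta (a ⊗ b) = (a ⊗ 1) * delta b.
Proof. exact: tliftE. Qed.

HB.instance Definition _ (dA : comodule_algebra delta) :=
  GRing.Linear.copy (can dA) (qlift (can_subproof dA)).

Lemma can_qproj (dA : comodule_algebra delta) x :
  can dA (qproj _ x) = ver delta x.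
Proof. exact: qliftE. Qed.

Lemma ver_lmul (a : A) x :
  ver delta ((a ⊗ 1) * x) = (a ⊗ 1) * ver delta x.
Proof.
elim/(@tens_ind k): x => [|c x y IHx IHy|b b'].
- by rewrite mulr0 !linear0 mulr0.
- by rewrite tmulP !linearP /= tmulP IHx IHy.
- by rewrite tpureM !ver_tpure mul1r mulrA tpureM mul1r.
Qed.

Section Can.
Hypothesis (dA : comodule_algebra delta) (bij_can : bijective (can dA)).

Lemma ver_surj z : exists y, ver delta y = z.
Proof.
have [g _ gK] := bij_can; have [y yE] := qproj_surj (g z).
by exists y; rewrite -(can_qproj dA) yE gK.
Qed.

Lemma ver_ker x : ver delta x = 0 -> span (balanced (coinvariants delta)) x.
Proof.
rewrite -(can_qproj dA) => vx0; apply/qproj_eq0P; apply: (bij_inj bij_can).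
by rewrite vx0 linear0.
Qed.

Lemma coefficient_space_full (L : set H) : subspace L ->
  (forall a, stens setT L (delta a)) -> L = setT.
Proof.
move=> sL dL; apply/seteqP; split=> // h _.
have n1 : (1 : A) <> 0 by apply/eqP; rewrite oner_neq0.
apply: (tpure_stens n1 sL); have [y <-] := ver_surj (1 ⊗ h).
elim/(@tens_ind k): y => [|c x y Lx Ly|a b].
- by rewrite linear0; exact: (stens_subspace _ _).1.
- by rewrite linearP; exact: (stens_subspace _ _).2.
rewrite ver_tpure.
(* Left multiplication by [a ⊗ 1] only changes the first factor, so it preserves [A ⊗ L]. *)
apply: (stens_min _ _ (dL b) (M := [set z | stens setT L ((a ⊗ 1) * z)])).
  split=> [|c u v Lu Lv] /=; first by rewrite mulr0; exact: (stens_subspace _ _).1.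
  by rewrite tmulP; exact: (stens_subspace _ _).2.
by move=> c l _ Ll /=; rewrite tpureM mul1r; apply: stens_pure.
Qed.

(** A Hopf subalgebra through which the coaction factors is in particular a subspace containing all
    coefficients, hence everything. *)
Lemma inner_faithful_can : inner_faithful delta.
Proof.
split=> [|a|L [[sL _] _ _ _]]; last by move/(coefficient_space_full sL) ->.
  by split=> //; split=> // x _; rewrite stens_setT.
by rewrite stens_setT.
Qed.

End Can.
End Coactions.

(** * First-order calculi as quotients of the tensor square *)

Section Calculi.
Local Open Scope classical_set_scope.
Context {k : fieldType} {A : algType k} (Omega : fodc A).

Lemma lact0r (a : A) : lact a (0 : Omega) = 0.
Proof.
have := (lact_bilinear Omega).2 a (-1) 0 0.
by rewrite /= scaler0 addr0 scaleN1r addNr.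
Qed.

Lemma ract0l (a : A) : ract (0 : Omega) a = 0.
Proof.
have := (ract_bilinear Omega).1 a (-1) 0 0.
by rewrite /= scaler0 addr0 scaleN1r addNr.
Qed.

Lemma lactDr (a : A) (v w : Omega) : lact a (v + w) = lact a v + lact a w.
Proof. by have := (lact_bilinear Omega).2 a 1 v w; rewrite /= !scale1r. Qed.

Lemma fodc_ker_subspace : subspace (fodc_ker Omega).
Proof.
split=> [|c x y [mx dx] [my dy]].
  by split; rewrite /universal_fodc /= linear0.
split; last by rewrite linearP /= dx dy scaler0 addr0.
rewrite /universal_fodc /= linearP /= (mx : tmult x = 0) (my : tmult y = 0).
by rewrite scaler0 addr0.
Qed.

Lemma ldiff_tpure a b : ldiff Omega (a ⊗ b) = lact a (diff Omega b).
Proof. exact: tliftE. Qed.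

Lemma diff1 : diff Omega 1 = 0.
Proof.
have := diffM Omega 1 1; rewrite mulr1 ract1 lact1 => /eqP.
by rewrite -subr_eq0 opprD addrA subrr sub0r oppr_eq0 => /eqP.
Qed.

Lemma fodc_ind (S : set Omega) : subspace S ->
  (forall a b, S (lact a (diff Omega b))) -> forall w, S w.
Proof.
move=> sS Sg w; have : [set: Omega] w by [].
by rewrite -(diff_gen Omega); apply: span_min => // _ [a [b ->]].
Qed.

Lemma ldiff_surj w : exists x, ldiff Omega x = w.
Proof.
suff : (ldiff Omega @` setT) w by case=> x _ <-; exists x.
apply: fodc_ind => [|a b]; first exact: subspace_image (subspaceT _).
by exists (a ⊗ b) => //; rewrite ldiff_tpure.
Qed.

(** Since [ldiff] maps [A ⊗ A] onto [Omega], well-definedness of [Delta_R] amounts to its formula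
    vanishing on the kernel of [ldiff]. This form needs no explicit [Delta_R] when passing to
    quotients. *)
Lemma covariantP (H : hopfAlgType k) (delta : {linear A -> tens A H}) :
  covariant Omega delta <->
  forall x, ldiff Omega x = 0 ->
    tmap (ldiff Omega) tmult (tmid (tmap delta delta x)) = 0.
Proof.
split=> [[D DE] x x0|D0].
  suff <- : D (ldiff Omega x) = tmap (ldiff Omega) tmult (tmid (tmap delta delta x)).
    by rewrite x0 linear0.
  elim/(@tens_ind k): x {x0} => [|c x y IHx IHy|a b]; first by rewrite !linear0.
    by rewrite !linearP /= IHx IHy.
  by rewrite ldiff_tpure DE tmapE.
have [D DE] := @linear_factor _ _ _ _ (ldiff Omega)
  (tmap (ldiff Omega) tmult \o @tmid k A H A H \o tmap delta delta) ldiff_surj D0.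
by exists D => a b; rewrite -ldiff_tpure DE /= tmapE.
Qed.

End Calculi.

(** * Descent of the bundle axioms along [pi] and [kappa] *)

Section QuotientBundle.
Local Open Scope classical_set_scope.
Context {k : fieldType} {H L : hopfAlgType k} {A A0 : algType k}.
Context (delta : {linear A -> tens A H}) (delta0 : {linear A0 -> tens A0 L}).
Context (Omega : fodc A) (Omega0 : fodc A0).
Context (pi : {lrmorphism A -> A0}) (kappa : {lrmorphism H -> L}).
Hypotheses (pi_surj : forall b, exists a, pi a = b)
  (delta0E : forall a, delta0 (pi a) = tmap pi kappa (delta a)).

Let pi2_surj x : exists y, tmap pi pi y = x.
Proof. exact: (tmap_surj pi_surj pi_surj). Qed.

Lemma comodule_algebra_quotient : hopf_morphism kappa ->
  comodule_algebra delta -> comodule_algebra delta0.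
Proof.
move=> [kD ke _] [dA de d1 dM]; split=> [b|b||b b'].
- have [a <-] := pi_surj b.
  have E1 x : tmap delta0 idfun (tmap pi kappa x) =
      tmap (tmap pi kappa) kappa (tmap delta idfun x).
    by rewrite !tmap_comp; apply: eq_tmap.
  have E2 x : tmap idfun comul (tmap pi kappa x) =
      tmap pi (tmap kappa kappa) (tmap idfun comul x).
    by rewrite !tmap_comp; apply: eq_tmap.
  by rewrite delta0E E1 tassoc_tmap dA E2.
- have [a <-] := pi_surj b.
  have E x : tmap idfun counit (tmap pi kappa x) =
      tmap pi idfun (tmap idfun counit x).
    by rewrite !tmap_comp; apply: eq_tmap.
  by rewrite delta0E E tscale_tmap de.
- by rewrite -(rmorph1 pi) delta0E d1 tmap1.
- have [[a <-] [a' <-]] := (pi_surj b, pi_surj b').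
  by rewrite -rmorphM !delta0E dM tmapM.
Qed.

Lemma ver_quotient x : ver delta0 (tmap pi pi x) = tmap pi kappa (ver delta x).
Proof.
elim/(@tens_ind k): x => [|c x y IHx IHy|a b]; first by rewrite !linear0.
  by rewrite !linearP /= IHx IHy.
by rewrite tmapE !ver_tpure delta0E tmapM tmapE /= rmorph1.
Qed.

(* As can is bijective, the kernel of pi ⊗ kappa, which is ker pi ⊗ H, is the
   image of ker pi ⊗ A under can. *)
Lemma can_quotient_bij (dA : comodule_algebra delta)
    (dA0 : comodule_algebra delta0) :
  bijective kappa -> bijective (can dA) -> bijective (can dA0).
Proof.
move=> [kinv kK Kk] bij_can.
have k_surj l : exists h, kappa h = l by exists (kinv l).
have can0_surj z : exists x, can dA0 x = z.
  have [y <-] := tmap_surj pi_surj k_surj z.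
  have [x <-] := ver_surj bij_can y.
  by exists (qproj _ (tmap pi pi x)); rewrite can_qproj ver_quotient.
suff can0_inj x : can dA0 x = 0 -> x = 0.
  have [g gK] := choice can0_surj; exists g => // x.
  apply/eqP; rewrite -subr_eq0; apply/eqP/can0_inj.
  by rewrite linearB /= gK subrr.
have [{}x <-] := qproj_surj x; have [{}x <-] := pi2_surj x.
rewrite can_qproj ver_quotient => vx0; apply/qproj_eq0P.
have {vx0}: tmap pi idfun (ver delta x) = 0.
  (* Composing with the inverse of [kappa] turns the kernel of [pi ⊗ kappa] into that of [pi ⊗ id],
     to which [tmap_ker] applies. *)
  have [kap [kapK _]] := lrmorphism_inv (Bijective kK Kk).
  have E z : tmap pi idfun z = tmap idfun kap (tmap pi kappa z).
    by rewrite !tmap_comp; apply: eq_tmap => // h /=; rewrite kapK.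
  by rewrite E vx0 linear0.
move/(tmap_ker pi_surj) => vK.
have [y /= piy0 vyx] : (ver delta @` [set y | tmap pi pi y = 0]) (ver delta x).
  apply: (stens_min _ _ vK) => [|a h /= a0 _].
    by apply: subspace_image; exact: subspace_preim (subspace0 _).
  have [z vz] := ver_surj bij_can (1 ⊗ h).
  exists ((a ⊗ 1) * z); last by rewrite ver_lmul vz tpureM mulr1 mul1r.
  by rewrite /= tmapM tmapE /= a0 tpure0l mul0r.
(* Now [x - y] has the same image as [x] under [pi ⊗ pi] and is a combination of balancing
   relations. These map to balancing relations because [pi] sends coinvariants to coinvariants. *)
have {vyx} : span (balanced (coinvariants delta)) (x - y).
  by apply: (ver_ker bij_can); rewrite linearB /= vyx subrr.
have -> : tmap pi pi x = tmap pi pi (x - y) by rewrite linearB /= piy0 subr0.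
apply: (span_min (S := [set z | span _ (tmap pi pi z)])).
  exact: subspace_preim (span_subspace _).
move=> _ [a [b [c [Bb ->]]]]; rewrite /= linearB /= !tmapE /= !rmorphM.
apply: span_gen; exists (pi a), (pi b), (pi c); split=> //.
by rewrite /coinvariants /= delta0E Bb tmapE /= rmorph1.
Qed.

Section Calculus.
Variable I : set A.
Hypotheses (pi_ker : forall a, pi a = 0 <-> I a)
  (calc : quotient_calculus Omega I pi Omega0).

(** On generators [a db], the Leibniz rule writes each relation using tensors with a factor in the
    kernel of [pi]: [i (a db) = (i a) db], [(a db) i = a d(b i) - (a b) di] and
    [a (di) b = a d(i b) - (a i) db]. *)
Lemma calculus_relations_ldiff w : @calculus_relations _ _ Omega I w ->
  exists2 x, tmap pi pi x = 0 & ldiff Omega x = w.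
Proof.
have sM : subspace (ldiff Omega @` [set x | tmap pi pi x = 0]).
  by apply: subspace_image; exact: subspace_preim (subspace0 _).
apply: (span_min sM) => _ [[[i [v [/pi_ker Ii ->]]]|[i [v [/pi_ker Ii ->]]]]
    |[a [i [b [/pi_ker Ii ->]]]]].
- apply: (fodc_ind (S := fun v => _ (lact i v))) v => [|a b].
    split=> [|c u v Mu Mv] /=; last by rewrite (lact_bilinear Omega).2; apply: sM.2.
    by rewrite lact0r; exact: sM.1.
  exists ((i * a) ⊗ b); last by rewrite ldiff_tpure lactM.
  by rewrite /= tmapE /= rmorphM /= Ii mul0r tpure0l.
- apply: (fodc_ind (S := fun v => _ (ract v i))) v => [|a b].
    split=> [|c u v Mu Mv] /=; last by rewrite (ract_bilinear Omega).1; apply: sM.2.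
    by rewrite ract0l; exact: sM.1.
  exists (a ⊗ (b * i) - (a * b) ⊗ i).
    rewrite /= linearB /= !tmapE /= rmorphM /= Ii mulr0.
    by rewrite !tpure0r subrr.
  rewrite linearB /= !ldiff_tpure diffM lactDr.
  by rewrite lactM addrK lractA.
- exists (a ⊗ (i * b) - (a * i) ⊗ b).
    rewrite /= linearB /= !tmapE /= !rmorphM /= Ii mul0r mulr0.
    by rewrite tpure0r tpure0l subrr.
  rewrite linearB /= !ldiff_tpure diffM lactDr.
  by rewrite lactM addrK lractA.
Qed.

Lemma ldiff_quotient : exists p : {linear Omega -> Omega0},
  (forall x, ldiff Omega0 (tmap pi pi x) = p (ldiff Omega x)) /\
  (forall v, p v = 0 <-> @calculus_relations _ _ Omega I v).
Proof.
have [p [_ pker pl _ pd]] := calc; exists p; split=> //.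
elim/(@tens_ind k) => [|c x y IHx IHy|a b]; first by rewrite !linear0.
  by rewrite !linearP /= IHx IHy.
by rewrite tmapE !ldiff_tpure pl /= pd.
Qed.

(** Any lift of [x0] has its differential form in the relations; subtracting a tensor that is killed
    by [pi ⊗ pi] and has the same form corrects the lift. *)
Lemma ldiff_ker_quotient x0 : ldiff Omega0 x0 = 0 ->
  exists2 x, tmap pi pi x = x0 & ldiff Omega x = 0.
Proof.
have [p [pE pker]] := ldiff_quotient; have [x <-] := pi2_surj x0.
rewrite pE => /pker/calculus_relations_ldiff[y piy0 yx].
by exists (x - y); rewrite linearB /= ?piy0 ?subr0 // yx subrr.
Qed.

Lemma fodc_ker_quotient : fodc_ker Omega0 = tmap pi pi @` fodc_ker Omega.
Proof.
apply/seteqP; split=> [x0 [mx0 dx0]|_ [x [mx dx] <-]]; last first.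
  split; first by rewrite /universal_fodc /= tmult_tmap mx linear0.
  by have [p [-> _]] := ldiff_quotient; rewrite dx linear0.
have [x xx0 dx] := ldiff_ker_quotient dx0.
(* Correcting x by an element of ker pi ⊗ 1, on which ldiff vanishes since
   d 1 = 0, moves it into the universal calculus. *)
exists (x - tmult x ⊗ 1); last first.
  rewrite linearB /= xx0 tmapE /= -tmult_tmap xx0.
  by rewrite [tmult x0]mx0 tpure0l subr0.
split; first by rewrite /universal_fodc /= linearB /= tmultE mulr1 subrr.
by rewrite linearB /= dx ldiff_tpure diff1 lact0r subrr.
Qed.

(** A kernel element is lifted to the kernel upstairs, where the covariance formula vanishes; [E1]
    and [E2] identify the formula downstairs with the image of that one under [p ⊗ kappa]. *)
Lemma covariant_quotient : covariant Omega delta -> covariant Omega0 delta0.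
Proof.
move/covariantP=> cov; apply/covariantP => x0 /ldiff_ker_quotient[x <- dx].
have [p [pE _]] := ldiff_quotient.
have E1 : tmap delta0 delta0 (tmap pi pi x) =
    tmap (tmap pi kappa) (tmap pi kappa) (tmap delta delta x).
  by rewrite !tmap_comp; apply: eq_tmap.
have E2 : forall z, tmap (ldiff Omega0) tmult
      (tmid (tmap (tmap pi kappa) (tmap pi kappa) z)) =
    tmap p kappa (tmap (ldiff Omega) tmult (tmid z)).
  apply: (tens_ext4 (f := tmap (ldiff Omega0) tmult \o @tmid k A0 L A0 L \o
      tmap (tmap pi kappa) (tmap pi kappa))
    (g := tmap p kappa \o tmap (ldiff Omega) tmult \o @tmid k A H A H)).
  move=> a h b h' /=; rewrite !tmapE /= !tmapE !tmidE !tmapE /=.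
  have := pE (a ⊗ b); rewrite tmapE /= => ->.
  by rewrite !tmultE rmorphM.
by rewrite E1 E2 cov // linear0.
Qed.

(** The isomorphism [kappa] absorbs the freedom in presenting the Hopf image: it will be the inverse
    of the embedding [iota]. *)
Lemma quantum_principal_bundle_quotient : bijective kappa ->
  hopf_morphism kappa -> quantum_principal_bundle Omega delta ->
  quantum_principal_bundle Omega0 delta0.
Proof.
move=> bk hk [bS dA cov bij_can [Q [[sQ Qm] Qe QAd verQ]]].
have dA0 := comodule_algebra_quotient hk dA.
have bij_can0 : bijective (can dA0) by exact: can_quotient_bij bij_can.
apply: (QuantumPrincipalBundle (antip_bij_morphism bk hk bS)
  (covariant_quotient cov) bij_can0).
have k_surj l : exists h, kappa h = l.
  by have [g _ gK] := bk; exists (g l).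
(* The ideal is transported by [kappa], whose surjectivity makes the image a right ideal of [L]. *)
exists (kappa @` Q); split.
- split=> [|_ l [q Qq <-]]; first exact: subspace_image.
  by have [h <-] := k_surj l; exists (q * h); rewrite ?rmorphM //; apply: Qm.
- by move=> _ [q Qq <-]; have [_ -> _] := hk; apply: Qe.
- move=> _ [q Qq <-]; rewrite Ad_R_morphism //.
  by apply: stens_tmap (QAd q Qq) => // h Qh; exists h.
rewrite fodc_ker_quotient; apply/seteqP; split.
  move=> _ [_ [x Nx <-] <-]; rewrite ver_quotient.
  have : stens setT Q (ver delta x) by rewrite -verQ; exists x.
  by apply: stens_tmap => // h Qh; exists h.
apply: stens_min => [|b _ _ [q Qq <-]].
  by do 2!apply: subspace_image; exact: fodc_ker_subspace.
(* The generator is the image under [pi ⊗ kappa] of [a ⊗ q], which is a value of [ver] on [N]. *)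
have [a <-] := pi_surj b.
have [x Nx xE] : (ver delta @` fodc_ker Omega) (a ⊗ q).
  by rewrite verQ; apply: stens_pure.
exists (tmap pi pi x); first by exists x.
by rewrite ver_quotient xE tmapE.
Qed.

End Calculus.
End QuotientBundle.

(** * The quotient of an algebra by a proper ideal *)

Section QuotientAlgebra.
Local Open Scope classical_set_scope.
Context {k : fieldType} {A : algType k} (I : set A).
Hypotheses (I_ideal : two_sided_ideal I) (I_proper : ~ I 1).

(** The two proofs are parameters of the type because its ring structure depends on them: the ideal
    property makes the product well defined, and properness gives that 1 differs from 0. *)
Definition quotalg of two_sided_ideal I & ~ I 1 : Type := quotv I.
Local Notation Q := (quotalg I_ideal I_proper).
HB.instance Definition _ := GRing.Lmodule.on Q.

Let pi : A -> Q := qproj I.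

Definition quotalg_mul (x y : Q) : Q :=
  pi (sval (cid (qproj_surj x)) * sval (cid (qproj_surj y))).

Let pi_eqP a b : pi a = pi b <-> I (a - b).
Proof. by rewrite /pi qproj_eqP span_id //; have [] := I_ideal. Qed.

Let piP (x : Q) : exists a, pi a = x. Proof. exact: qproj_surj. Qed.

Let piM a b : quotalg_mul (pi a) (pi b) = pi (a * b).
Proof.
rewrite /quotalg_mul; case: cid => a' /= /pi_eqP aa'.
case: cid => b' /= /pi_eqP bb'; apply/pi_eqP; have [sI mI] := I_ideal.
have -> : a' * b' - a * b = a' * (b' - b) + (a' - a) * b.
  by rewrite mulrBr mulrBl addrA subrK.
by apply: subspaceD => //; [apply: (mI _ _ _).1|apply: (mI _ _ _).2].
Qed.

Fact quotalg_mulA : associative quotalg_mul.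
Proof.
move=> x y z; have [[a <-] [[b <-] [c <-]]] := (piP x, (piP y, piP z)).
by rewrite !piM mulrA.
Qed.

Fact quotalg_mul1l : left_id (pi 1) quotalg_mul.
Proof. by move=> x; have [a <-] := piP x; rewrite piM mul1r. Qed.

Fact quotalg_mul1r : right_id (pi 1) quotalg_mul.
Proof. by move=> x; have [a <-] := piP x; rewrite piM mulr1. Qed.

Fact quotalg_mulDl : left_distributive quotalg_mul +%R.
Proof.
move=> x y z; have [[a <-] [[b <-] [c <-]]] := (piP x, (piP y, piP z)).
by rewrite !piM -!qprojD piM mulrDl.
Qed.

Fact quotalg_mulDr : right_distributive quotalg_mul +%R.
Proof.
move=> x y z; have [[a <-] [[b <-] [c <-]]] := (piP x, (piP y, piP z)).
by rewrite !piM -!qprojD piM mulrDr.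
Qed.

Fact quotalg_nonzero : pi 1 != 0.
Proof.
apply/eqP; rewrite -[0]/(0 : quotv I) -(linear0 (qproj I)) => /pi_eqP.
by rewrite subr0.
Qed.

HB.instance Definition _ := GRing.Zmodule_isNzRing.Build Q
  quotalg_mulA quotalg_mul1l quotalg_mul1r quotalg_mulDl quotalg_mulDr
  quotalg_nonzero.

Fact quotalg_scalerAl (c : k) (x y : Q) : c *: (x * y) = (c *: x) * y.
Proof.
have [[a <-] [b <-]] := (piP x, piP y).
rewrite -[_ * _]/(quotalg_mul _ _) -[c *: pi a]/(qscale c (pi a)).
rewrite -[RHS]/(quotalg_mul _ _) piM -[LHS]/(qscale c _).
by rewrite [LHS]qscaleE [qscale c (pi a)]qscaleE [RHS]piM scalerAl.
Qed.
HB.instance Definition _ := GRing.Lmodule_isLalgebra.Build k Q quotalg_scalerAl.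

Fact quotalg_scalerAr (c : k) (x y : Q) : c *: (x * y) = x * (c *: y).
Proof.
have [[a <-] [b <-]] := (piP x, piP y).
rewrite -[_ * _]/(quotalg_mul _ _) -[c *: pi b]/(qscale c (pi b)).
rewrite -[RHS]/(quotalg_mul _ _) piM -[LHS]/(qscale c _).
by rewrite [LHS]qscaleE [qscale c (pi b)]qscaleE [RHS]piM scalerAr.
Qed.
HB.instance Definition _ := GRing.Lalgebra_isAlgebra.Build k Q quotalg_scalerAr.

Lemma quotient_algebra : exists (A0 : algType k) (p : {lrmorphism A -> A0}),
  (forall b, exists a, p a = b) /\ (forall a, p a = 0 <-> I a).
Proof.
have pL : linear pi by exact: (qproj_linear I).
have pM : monoid_morphism pi by split=> // a b; rewrite -[RHS]piM.
exists Q, (HB.pack_for {lrmorphism A -> Q} pi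
  (GRing.isLinear.Build k A Q *:%R pi pL)
  (GRing.isMonoidMorphism.Build A Q pi pM)).
split=> [|a] /=; first exact: piP.
by rewrite -[X in I X]subr0 -pi_eqP /pi linear0.
Qed.

End QuotientAlgebra.

(** * Construction of the induced calculus *)

Section QuotientCalculus.
Local Open Scope classical_set_scope.
Context {k : fieldType} {A A0 : algType k} (Omega : fodc A) (I : set A).
Context (pi : {lrmorphism A -> A0}).
Hypotheses (I_ideal : two_sided_ideal I)
  (pi_surj : forall b, exists a, pi a = b) (pi_ker : forall a, pi a = 0 <-> I a).

Local Notation R := (@calculus_relations k A Omega I).
Local Notation p := (qproj R).

Let sR : subspace R. Proof. exact: span_subspace. Qed.

(** Together with the right-handed version this makes the relations a sub-bimodule, so that both
    actions descend. *)
Lemma calculus_relations_lact a w : R w -> R (lact a w).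
Proof.
move: w; apply: (span_min (S := [set w | R (lact a w)])).
  split=> [|c u v Ru Rv] /=; first by rewrite lact0r; exact: sR.1.
  by rewrite (lact_bilinear Omega).2; apply: sR.2.
move=> _ [[[i [v [Ii ->]]]|[i [v [Ii ->]]]]|[b [i [c [Ii ->]]]]] /=; apply: span_gen.
- left; left; exists (a * i), v; rewrite lactM; split=> //.
  exact: (I_ideal.2 _ _ _).1.
- by left; right; exists i, (lact a v); rewrite lractA.
- by right; exists (a * b), i, c; rewrite lactM !lractA.
Qed.

Lemma calculus_relations_ract a w : R w -> R (ract w a).
Proof.
move: w; apply: (span_min (S := [set w | R (ract w a)])).
  split=> [|c u v Ru Rv] /=; first by rewrite ract0l; exact: sR.1.
  by rewrite (ract_bilinear Omega).1; apply: sR.2.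
move=> _ [[[i [v [Ii ->]]]|[i [v [Ii ->]]]]|[b [i [c [Ii ->]]]]] /=; apply: span_gen.
- by left; left; exists i, (ract v a); rewrite lractA.
- left; right; exists (i * a), v; rewrite ractM; split=> //.
  exact: (I_ideal.2 _ _ _).2.
- by right; exists b, i, (c * a); rewrite ractM.
Qed.

Let pP w w' : p w = p w' <-> R (w - w').
Proof. by rewrite qproj_eqP span_id. Qed.

Let lactBl (a b : A) (w : Omega) : lact (a - b) w = lact a w - lact b w.
Proof.
by have := (lact_bilinear Omega).1 w (-1) b a; rewrite /= !scaleN1r ![- _ + _]addrC.
Qed.

Let lactBr (a : A) (w w' : Omega) : lact a (w - w') = lact a w - lact a w'.
Proof.
by have := (lact_bilinear Omega).2 a (-1) w' w; rewrite /= !scaleN1r ![- _ + _]addrC.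
Qed.

Let ractBl (a : A) (w w' : Omega) : ract (w - w') a = ract w a - ract w' a.
Proof.
by have := (ract_bilinear Omega).1 a (-1) w' w; rewrite /= !scaleN1r ![- _ + _]addrC.
Qed.

Let ractBr (a b : A) (w : Omega) : ract w (a - b) = ract w a - ract w b.
Proof.
by have := (ract_bilinear Omega).2 w (-1) b a; rewrite /= !scaleN1r ![- _ + _]addrC.
Qed.

(** The actions are defined through chosen representatives [s] and [r]; once [laE] and [raE] show
    independence of the choice, every bimodule axiom is inherited from [Omega]. *)
Lemma quotient_calculus_exists :
  exists Omega0 : fodc A0, quotient_calculus Omega I pi Omega0.
Proof.
have [s sK] := choice pi_surj; have [r rK] := choice (@qproj_surj _ _ R).
have Is a : I (s (pi a) - a) by apply/pi_ker; rewrite linearB /= sK subrr.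
have Rr w : R (r (p w) - w) by apply/pP; rewrite rK.
pose la a (v : quotv R) := p (lact (s a) (r v)).
pose ra (v : quotv R) a := p (ract (r v) (s a)).
have laE a w : la (pi a) (p w) = p (lact a w).
  (* The difference splits as [(s (pi a) - a) r (p w) + a (r (p w) - w)]: the first term has a
     coefficient in [I], the second is [a] acting on a relation. *)
  apply/pP; rewrite -[lact (s _) _](subrK (lact a (r (p w)))) -lactBl -addrA.
  rewrite -lactBr; apply: (subspaceD sR); last exact: calculus_relations_lact.
  by apply: span_gen; left; left; exists (s (pi a) - a), (r (p w)).
have raE a w : ra (p w) (pi a) = p (ract w a).
  apply/pP; rewrite -[ract _ (s _)](subrK (ract (r (p w)) a)) -ractBr -addrA.
  rewrite -ractBl; apply: (subspaceD sR); last exact: calculus_relations_ract.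
  by apply: span_gen; left; right; exists (s (pi a) - a), (r (p w)).
have la_bil : bilinear_for *:%R *:%R la.
  split=> [v|b] c x y /=.
    rewrite -[x]sK -[y]sK -[v]rK -linearP !laE (lact_bilinear Omega).1.
    by rewrite linearP.
  by rewrite -[b]sK -[x]rK -[y]rK -linearP !laE (lact_bilinear Omega).2 linearP.
have ra_bil : bilinear_for *:%R *:%R ra.
  split=> [b|v] c x y /=.
    by rewrite -[b]sK -[x]rK -[y]rK -linearP !raE (ract_bilinear Omega).1 linearP.
  rewrite -[x]sK -[y]sK -[v]rK -linearP !raE (ract_bilinear Omega).2.
  by rewrite linearP.
have la1 v : la 1 v = v by rewrite -[v]rK -(rmorph1 pi) laE lact1.
have laM a b v : la (a * b) v = la a (la b v).
  by rewrite -[v]rK -[a]sK -[b]sK -rmorphM !laE lactM.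
have ra1 v : ra v 1 = v by rewrite -[v]rK -(rmorph1 pi) raE ract1.
have raM v a b : ra v (a * b) = ra (ra v a) b.
  by rewrite -[v]rK -[a]sK -[b]sK -rmorphM !raE ractM.
have lra a v b : ra (la a v) b = la a (ra v b).
  by rewrite -[v]rK -[a]sK -[b]sK !(laE, raE) lractA.
pose M := Bimodule la_bil ra_bil la1 laM ra1 raM lra.
have pd0 a : pi a = 0 -> (p \o diff Omega) a = 0.
  (* [qproj R] divides by the span of [R], itself a span, hence two uses of [span_gen]. The relation
     used is [1 (da) 1]. *)
  move=> /pi_ker Ia; apply/qproj_eq0P; apply: span_gen; apply: span_gen; right.
  by exists 1, a, 1; rewrite ract1 lact1.
have [d dE] := linear_factor pi_surj pd0.
have dM a b : (d : A0 -> M) (a * b) = ract (d a : M) b + lact a (d b : M).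
  rewrite -[a]sK -[b]sK -rmorphM !dE /= diffM raE laE.
  by rewrite linearD.
have dg : span [set w : M | exists a b, w = lact a (d b : M)] = setT.
  set X := [set w | _]; apply/seteqP; split=> // v _; rewrite -[v]rK.
  apply: (fodc_ind (S := fun w => span X (p w))).
    exact: (subspace_preim p (span_subspace X)).
  move=> a b; apply: span_gen; exists (pi a), (pi b).
  by rewrite dE /= laE.
exists (@Fodc k A0 M d dM dg), p; split=> //.
- exact: qproj_surj.
- move=> v; split=> [/qproj_eq0P|Rv]; first by rewrite span_id.
  by apply/qproj_eq0P; apply: span_gen.
- by move=> a w; exact: esym (laE a w).
- by move=> w a; exact: esym (raE a w).
Qed.

End QuotientCalculus.

(** * Existence and properties of the Hopf-image reduction *)

Section Reduction.
Local Open Scope classical_set_scope.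
Context {k : fieldType} {H : hopfAlgType k} {A : algType k}.

(** Zorn's lemma starting from the zero ideal. A chain's union stays proper because no member
    contains 1, and stable because each element is already stable within its own member. *)
Lemma maximal_stable_ideal_exists (delta : {linear A -> tens A H}) :
  exists I, maximal_stable_ideal delta I.
Proof.
apply: (@Zorn_bigcup_nonempty A (proper_stable_ideal delta) [set 0]).
- split; last 1 first.
  + by move=> _ ->; rewrite linear0; exact: (stens_subspace _ _).1.
  + split; first exact: subspace0.
    by move=> a _ ->; rewrite /= mulr0 mul0r.
  + by move/eqP; rewrite oner_eq0.
- by exists 0.
move=> F Fn0 FP Ft; split.
- split=> [|a x [S FS Sx]].
    by apply: subspace_bigcup => // S /FP[[]].
  by have [[_ /(_ a x Sx)[]]] := FP _ FS; split; exists S.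
- by case=> S /FP[].
- move=> x [S FS Sx]; have [_ _ /(_ x Sx)] := FP _ FS.
  by apply: subset_stens => // y Sy; exists S.
Qed.

Lemma hopf_image_reduction_exists (Omega : fodc A)
    (delta : {linear A -> tens A H}) :
  quantum_principal_bundle Omega delta ->
  exists (A0 : algType k) (Omega0 : fodc A0) (L : hopfAlgType k)
    (delta0 : {linear A0 -> tens A0 L}),
    hopf_image_reduction Omega delta Omega0 delta0.
Proof.
move=> [_ dA _ bij_can _].
have [I [[I_ideal I_proper I_stable] Imax]] := maximal_stable_ideal_exists delta.
have [A0 [pi [pi_surj pi_ker]]] := quotient_algebra I_ideal I_proper.
have [Omega0 calc] := quotient_calculus_exists Omega I_ideal pi_surj pi_ker.
(* Stability of [I] puts [delta a] in [I ⊗ H], killed by [pi ⊗ id], whenever [a] lies in [I]; hence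
   the coaction descends. *)
have [delta0 delta0E] : exists delta0 : {linear A0 -> tens A0 H},
    forall a, delta0 (pi a) = tmap pi idfun (delta a).
  apply: (linear_factor (g := tmap pi idfun \o delta) pi_surj).
  move=> a /pi_ker /I_stable da /=.
  apply: (stens_min _ _ da (M := [set x | tmap pi idfun x = 0])).
    exact: subspace_preim (subspace0 _).
  by move=> i h /pi_ker i0 _; rewrite /= tmapE /= i0 tpure0l.
(* As the Hopf image is all of [H], it is presented by the identity, and the corestriction is
   [delta] itself. *)
exists A0, Omega0, H, delta0, idfun, delta, I, pi; split=> //.
- split=> //; first by split=> x //=; rewrite tmap_id.
  by rewrite image_id; exact: inner_faithful_can bij_can.
- by move=> a; rewrite tmap_id.
Qed.

Lemma hopf_image_reduction_bundle (Omega : fodc A)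
    (delta : {linear A -> tens A H}) (A0 : algType k) (Omega0 : fodc A0)
    (L : hopfAlgType k) (delta0 : {linear A0 -> tens A0 L}) :
  quantum_principal_bundle Omega delta ->
  hopf_image_reduction Omega delta Omega0 delta0 ->
  quantum_principal_bundle Omega0 delta0 /\ inner_faithful delta0.
Proof.
move=> qpb [iota [delta_im [I [pi [[iota_inj iota_hopf [[[siota _] _ _ _] diota _]]
  dimE _ [pi_surj pi_ker] [delta0E calc]]]]]].
have [_ dA _ bij_can _] := qpb.
(* The range of [iota] contains all coefficients of [delta], so it is everything and the injective
   [iota] is an isomorphism. *)
have iota_surj : range iota = setT.
  exact: coefficient_space_full bij_can _ siota diota.
have iota_bij : bijective iota.
  have /choice[g gK] : forall h, exists l, iota l = h.
    by move=> h; have [l _ <-] : range iota h; [rewrite iota_surj|exists l].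
  by exists g => // l; apply: iota_inj; rewrite gK.
have [kappa [iotaK kappaK]] := lrmorphism_inv iota_bij.
have kappa_hopf := hopf_morphism_inv iotaK kappaK iota_hopf.
have d0E a : delta0 (pi a) = tmap pi kappa (delta a).
  rewrite delta0E -dimE tmap_comp; apply: eq_tmap => // l.
  by rewrite /= iotaK.
have qpb0 : quantum_principal_bundle Omega0 delta0.
  apply: (quantum_principal_bundle_quotient pi_surj d0E pi_ker) qpb => //.
  by exists iota.
(* Inner faithfulness is read off from the bijective canonical map of the reduced bundle. *)
by split=> //; have [_ dA0 _ bij_can0 _] := qpb0; exact: inner_faithful_can bij_can0.
Qed.

End Reduction.

Theorem corollary4p10 (k : fieldType) (H : hopfAlgType k) (A : algType k)
    (Omega : fodc A) (delta : {linear A -> tens A H}) :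
  cosemisimple H -> quantum_principal_bundle Omega delta ->
  (exists (A0 : algType k) (Omega0 : fodc A0) (L : hopfAlgType k)
      (delta0 : {linear A0 -> tens A0 L}),
    hopf_image_reduction Omega delta Omega0 delta0)
  /\
  (forall (A0 : algType k) (Omega0 : fodc A0) (L : hopfAlgType k)
      (delta0 : {linear A0 -> tens A0 L}),
    hopf_image_reduction Omega delta Omega0 delta0 ->
    quantum_principal_bundle Omega0 delta0 /\ inner_faithful delta0).
Proof.
move=> _ qpb; split; first exact: hopf_image_reduction_exists.
by move=> A0 Omega0 L delta0; apply: hopf_image_reduction_bundle.
Qed.
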